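(* Let $k>r\ge2$ be integers, and let $G\sim\mathcal{G}(n,p)$ with $p=p(n)$. There are constants $C,c>0$ (depending only on $k$ and $r$) such that: 1. If $np^k>C\log n$, then w.h.p. $\mathrm{tc}_r(G)\le\mathrm{hp}_r(k)$. 2. If $np^{k+1}<c\log n$, then w.h.p. $\mathrm{tc}_{r+1}(G)\ge\mathrm{hp}_r(k)+1$.
   Context: $\mathcal{G}(n,p)$ is the binomial random graph on $n$ vertices, in which each pair of vertices is an edge independently with probability $p=p(n)$. ''W.h.p.'' means with probability tending to $1$ as $n\to\infty$. $\log$ is the natural logarithm. For a graph $G$ and $s\ge1$, $\mathrm{tc}_s(G)$ is the minimum $m$ such that for every colouring of the edges of $G$ with $s$ colours there is a collection of at most $m$ monochromatic trees in $G$ (subgraphs that are trees all of whose edges have the same colour; a single vertex counts as a monochromatic tree) that together cover all vertices of $G$ (trees may overlap). An $r$-graph is an $r$-uniform hypergraph (all edges have size $r$). It is $r$-partite if its vertex set is partitioned into parts $V_1,\dots,V_r$ with every edge meeting each $V_i$ in exactly one vertex. A cover of a hypergraph is a set of vertices meeting every edge; the cover number $\tau(H)$ is the minimum size of a cover. A transversal cover of (a subgraph of) an $r$-partite $r$-graph is a cover containing exactly one vertex from each part $V_i$. An $r$-partite $r$-graph $H$ has the $r$-partite $k$-covering property if every subgraph of $H$ with at most $k$ edges has a transversal cover. $\mathrm{hp}_r(k)$ is the largest possible cover number of an $r$-partite $r$-graph with the $r$-partite $k$-covering property if such a maximum exists, and $\mathrm{hp}_r(k)=\infty$ otherwise. 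*)

(* Defs.v *)
From HB Require Import structures.
From mathcomp Require Import all_boot all_order all_algebra.
From mathcomp Require Import all_classical all_reals all_analysis.

Set Implicit Arguments.
Unset Strict Implicit.
Unset Printing Implicit Defensive.

Import Order.TTheory GRing.Theory Num.Theory.
Import numFieldNormedType.Exports.
(* classical_sets shadows set0, setT and similar names of finset. *)
From mathcomp Require Import finset.

Definition pairs (V : finType) : {set {set V}} := [set e : {set V} | #|e| == 2].

Record sgraph (V : finType) := SGraph {
  edges : {set {set V}};
  edges_pairs : edges \subset pairs V }.

HB.instance Definition _ (V : finType) := [isSub for @edges V].
HB.instance Definition _ (V : finType) := [Finite of sgraph V by <:].

(* A subgraph is given by its vertex set and its edge set. *)
Definition subgraph_of (V : finType) (G : sgraph V)
    (W : {set V}) (F : {set {set V}}) : Prop :=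
  F \subset edges G /\ forall e, e \in F -> e \subset W.

Definition adj (V : finType) (F : {set {set V}}) : rel V :=
  fun x y => [set x; y] \in F.

Definition connected_graph (V : finType) (W : {set V}) (F : {set {set V}}) : Prop :=
  W != set0 /\ forall x y, x \in W -> y \in W -> connect (adj F) x y.

Definition acyclic_graph (V : finType) (F : {set {set V}}) : Prop :=
  forall s : seq V, 2 < size s -> ~ ucycle (adj F) s.

Definition is_tree (V : finType) (W : {set V}) (F : {set {set V}}) : Prop :=
  connected_graph W F /\ acyclic_graph F.

(* Colourings are total on sets of vertices; only the values on edges of G
   are ever used. *)
Definition mono_tree (V : finType) (G : sgraph V) (s : nat)
    (c : {set V} -> 'I_s) (T : {set V} * {set {set V}}) : Prop :=
  [/\ subgraph_of G T.1 T.2, is_tree T.1 T.2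
    & forall e f, e \in T.2 -> f \in T.2 -> c e = c f].

Definition tree_coverable (V : finType) (s : nat) (G : sgraph V) (m : nat) : Prop :=
  forall c : {set V} -> 'I_s,
  exists Ts : {set {set V} * {set {set V}}},
    [/\ #|Ts| <= m,
        forall T, T \in Ts -> mono_tree G c T
      & forall v, exists2 T, T \in Ts & v \in T.1].

Lemma mono_tree1 (V : finType) (G : sgraph V) (s : nat) (c : {set V} -> 'I_s)
  (v : V) : mono_tree G c ([set v], set0).
Proof.
split=> /=.
- by split=> [|e]; rewrite ?sub0set ?inE.
- split; first split.
  + by apply/set0Pn; exists v; rewrite inE.
  + by move=> x y; rewrite !inE => /eqP-> /eqP->.
  + by case=> [|x [|y s']] //= _ /andP[/=]; rewrite /adj inE.
- by move=> e f; rewrite inE.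
Qed.

Lemma tree_coverable_ex (V : finType) (s : nat) (G : sgraph V) :
  exists m, `[< tree_coverable s G m >].
Proof.
exists #|V|; apply/asboolP => c.
exists [set ([set v], set0) | v : V]; split.
- exact: leq_imset_card.
- by move=> T /imsetP[v _ ->]; apply: mono_tree1.
- by move=> v; exists ([set v], set0); [apply: imset_f | rewrite inE].
Qed.

Definition tc (V : finType) (s : nat) (G : sgraph V) : nat :=
  ex_minn (tree_coverable_ex s G).

Definition uniform (V : finType) (r : nat) (H : {set {set V}}) : Prop :=
  forall e, e \in H -> #|e| = r.

(* [part] sends each vertex to the index of the part containing it. *)
Definition partite (V : finType) (r : nat) (part : V -> 'I_r)
    (H : {set {set V}}) : Prop :=
  forall e, e \in H -> forall i, #|[set v in e | part v == i]| = 1.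

Definition is_cover (V : finType) (H : {set {set V}}) (S : {set V}) : bool :=
  [forall e in H, S :&: e != set0].

(* If set0 is an edge there is no cover; this is excluded by uniformity for
   r > 0. *)
Definition cover_number (V : finType) (H : {set {set V}}) : nat :=
  #|[arg min_(S < [set: V] | is_cover H S) #|S|]|.

Definition transversal_cover (V : finType) (r : nat) (part : V -> 'I_r)
    (H : {set {set V}}) (S : {set V}) : Prop :=
  is_cover H S /\ forall i, #|[set v in S | part v == i]| = 1.

Definition covering_property (V : finType) (r k : nat) (part : V -> 'I_r)
    (H : {set {set V}}) : Prop :=
  forall H' : {set {set V}}, H' \subset H -> #|H'| <= k ->
  exists S, transversal_cover part H' S.

Definition hp_value (r k m : nat) : Prop :=
  exists (V : finType) (part : V -> 'I_r) (H : {set {set V}}),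
    [/\ uniform r H, partite part H, covering_property k part H
      & cover_number H = m].

Definition hp_max (r k m : nat) : Prop :=
  hp_value r k m /\ forall m', hp_value r k m' -> m' <= m.

Local Open Scope classical_set_scope.
Local Open Scope ring_scope.

Definition hp (R : realType) (r k : nat) : \bar R :=
  match pselect (exists m, hp_max r k m) with
  | left ex => ((sval (cid ex))%:R)%:E
  | right _ => +oo%E
  end.

Definition gnp_weight (R : realType) (n : nat) (p : R) (G : sgraph 'I_n) : R :=
  \prod_(e in pairs 'I_n) (if e \in edges G then p else 1 - p).

Definition gnp_prob (R : realType) (n : nat) (p : R) (A : pred (sgraph 'I_n)) : R :=
  \sum_(G : sgraph 'I_n | A G) gnp_weight p G.

Definition whp (R : realType) (p : nat -> R)
    (A : forall n, pred (sgraph 'I_n)) : Prop :=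
  (fun n => gnp_prob (p n) (A n)) @ \oo --> (1 : R).

(* Main.v *)
Require Import Defs.
From HB Require Import structures.
From mathcomp Require Import all_boot all_order all_algebra.
From mathcomp Require Import all_classical all_reals all_analysis.
From mathcomp Require Import ring lra.
Import Order.TTheory GRing.Theory Num.Theory.
Import numFieldNormedType.Exports.
From mathcomp Require Import fintype fingraph finset.
Set Implicit Arguments.
Unset Strict Implicit.
Unset Printing Implicit Defensive.

(** Both parts translate between monochromatic trees in a graph and vertex
    covers of an r-partite r-graph.  Write h for hp_r(k).  It is finite when
    k > r: r + 1 pairwise disjoint edges have no transversal cover, since a
    transversal has only r vertices, so a maximal matching has at most r edges
    and its union is a cover with at most r^2 vertices (hp_max_exists).

    Upper bound.  Given an r-colouring of G, take the components of colour i
    as the i-th part of a hypergraph, and let every vertex v of G give the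
    edge consisting of the r components containing v.  If w is a common
    neighbour of v_1, ..., v_k, then v_j and w share the component of the
    colour of w v_j, so the edge of w is a transversal cover of the edges of
    v_1, ..., v_k.  Hence if any k vertices of G have a common neighbour, this
    hypergraph has a cover with at most h vertices, which is a family of
    components covering G, and their spanning trees prove tc_r(G) <= h
    (tc_le_hp).  With n p^k > (k + 1) log n, a union bound over k-tuples shows
    that common neighbours exist w.h.p.

    Lower bound.  Fix an extremal hypergraph H, with cover number h.  Suppose
    that G contains an independent set indexed by the edges of H such that
    every other vertex w sees at most k of its members, and some vertex w0
    sees none.  The edges of H seen by w have a transversal cover T_w; give
    the edge from w to the vertex of e a colour i such that T_w and e share
    their vertex in part i, and give colour r + 1 to all other edges of G.  A
    tree of colour i <= r has constant T_w- and e-vertices in part i, hence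
    acts on H as a single vertex of H.  So at least h trees are needed for the
    independent set, and one more for w0 (tc_gt_cover_number).

    To find this configuration, let s = log n / (16 (k + 1)) and take about
    e^(2s) disjoint blocks of constant size.  Their union U is independent
    w.h.p. because its size is such a small power of n.  Each block
    has no outside vertex with more than k neighbours in it with probability
    at least e^(-s), and these events are independent for different blocks, as
    they concern disjoint sets of pairs; so some block is good w.h.p.
    (whp_tc_gt).  Since U is independent, vertices of U outside the block see
    nothing of the block; a spare vertex in each block serves as w0. *)

(** * Finiteness of the extremal cover number *)

Lemma cover_number_le (V : finType) (H : {set {set V}}) (S : {set V}) :
  is_cover H S -> cover_number H <= #|S|.
Proof.
move=> cS; rewrite /cover_number; case: arg_minnP => [|S0 _ /(_ _ cS) //].
apply/forall_inP => e eH; apply: contraTneq cS => e0; rewrite setTI in e0.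
by apply/forall_inPn; exists e; rewrite // negbK e0 setI0.
Qed.

Lemma uniform_is_coverT (V : finType) (r : nat) (H : {set {set V}}) :
  0 < r -> uniform r H -> is_cover H [set: V].
Proof.
move=> r0 uH; apply/forall_inP => e eH; rewrite setTI -card_gt0.
by rewrite (uH _ eH).
Qed.

Lemma cover_number_witness (V : finType) (r : nat) (H : {set {set V}}) :
  0 < r -> uniform r H -> exists2 S, is_cover H S & #|S| = cover_number H.
Proof.
move=> r0 uH; rewrite /cover_number.
case: arg_minnP => [|S cS _]; first exact: uniform_is_coverT uH.
by exists S.
Qed.

Lemma transversal_card (V : finType) (r : nat) (part : V -> 'I_r) (S : {set V}) :
  (forall i, #|[set v in S | part v == i]| = 1) -> #|S| = r.
Proof.
move=> S1; rewrite -sum1_card (partition_big part xpredT) //=.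
rewrite -[RHS]card_ord -sum1_card; apply: eq_bigr => i _.
rewrite -[RHS](S1 i) -sum1_card; apply: eq_bigl => v; by rewrite inE.
Qed.

Lemma transversal_inj (V : finType) (r : nat) (part : V -> 'I_r) (S : {set V}) :
  (forall i, #|[set v in S | part v == i]| = 1) ->
  {in S &, injective part}.
Proof.
move=> S1 x y xS yS pxy.
have /eqP/cards1P[z zE] := S1 (part y).
have: x \in [set v in S | part v == part y] by rewrite inE xS pxy eqxx.
have: y \in [set v in S | part v == part y] by rewrite inE yS eqxx.
by rewrite zE !inE => /eqP-> /eqP->.
Qed.

(** A transversal has r vertices and each meets at most one member of a
    disjoint family, so r + 1 members already violate the covering property. *)
Lemma card_disjoint_family (V : finType) (r k : nat) (part : V -> 'I_r)
    (H M : {set {set V}}) :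
  r < k -> covering_property k part H -> M \subset H -> trivIset M ->
  #|M| <= r.
Proof.
move=> rk cH MH tM; rewrite leqNgt; apply/negP => rM.
have [M' M'M M'r] : exists2 M' : {set {set V}}, M' \subset M & #|M'| = r.+1.
  have := rM; rewrite -bin_gt0 -cards_draws => /card_gt0P[M'].
  by rewrite inE => /andP[M'M /eqP]; exists M'.
have [||S' [/forall_inP cS' /transversal_card S'r]] := cH M'.
- exact: subset_trans M'M MH.
- by rewrite M'r.
have tM' : trivIset M'.
  by apply/trivIsetP => A B AM BM; apply: (trivIsetP tM); apply: (subsetP M'M).
(* A vertex of the transversal chosen in e; injective because the members of
   M' are disjoint. *)
pose g (e : {set V}) : option V := [pick x in S' :&: e].
have gP e : e \in M' -> exists2 x, x \in S' :&: e & g e = Some x.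
  move=> eM; rewrite /g; case: pickP => [x xe|]; first by exists x.
  by move/set0Pn: (cS' _ eM) => [x xe] /(_ x); rewrite xe.
have ginj : {in M' &, injective g}.
  move=> e f eM fM.
  have [x /setIP[_ xe] ->] := gP _ eM; have [y /setIP[_ yf] ->] := gP _ fM.
  case=> xy; subst y; apply/eqP; apply: contraT => ef.
  have := trivIsetP tM' _ _ eM fM ef.
  by rewrite -setI_eq0 => /eqP/setP/(_ x); rewrite !inE xe yf.
have gS : g @: M' \subset [set Some x | x in S'].
  apply/fintype.subsetP => _ /imsetP[e eM ->].
  by have [x /setIP[xS _] ->] := gP _ eM; apply: imset_f.
have := leq_trans (subset_leq_card gS) (leq_imset_card _ _).
by rewrite (card_in_imset ginj) M'r S'r ltnn.
Qed.

(** The union of a maximum matching is a cover: an edge missing it could be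
    added to the matching. *)
Lemma hp_value_bounded (r k m : nat) :
  0 < r -> r < k -> hp_value r k m -> m <= r * r.
Proof.
move=> r0 rk [V [part [H [uH _ cH <-]]]].
pose Q := [pred M : {set {set V}} | (M \subset H) && trivIset M].
have Q0 : Q set0 by rewrite /Q /= sub0set; apply/trivIsetP => A B; rewrite inE.
have [M /andP[MH tM] maxM] := arg_maxnP (fun M : {set {set V}} => #|M|) Q0.
have Mr := card_disjoint_family rk cH MH tM.
have covM : is_cover H (cover M).
  apply/forall_inP => e eH; apply/negP => /eqP eM0.
  have eM : e \notin M.
    apply/negP => eM; have /setIidPr eE : e \subset cover M by apply: (bigcup_sup e).
    by move: r0; rewrite -(uH _ eH) -eE eM0 cards0.
  suff QeM : Q (e |: M).
    have : #|e |: M| <= #|M| by exact: maxM.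
    by rewrite cardsU1 eM add1n ltnn.
  rewrite /Q /= subUset sub1set eH MH /=.
  have dM B : B \in M -> [disjoint e & B].
    move=> BM; rewrite -setI_eq0 -subset0 -eM0 setIC; apply: setSI.
    exact: (bigcup_sup B).
  apply/trivIsetP => A B; rewrite !inE => /orP[/eqP->|AM] /orP[/eqP->|BM].
  - by rewrite eqxx.
  - by move=> _; apply: dM.
  - by move=> _; rewrite disjoint_sym; apply: dM.
  - exact: (trivIsetP tM).
apply: leq_trans (cover_number_le covM) _.
apply: leq_trans (leq_card_cover M) _.
rewrite (eq_bigr (fun=> r)) => [|A AM]; last by apply: uH; apply: (subsetP MH).
by rewrite sum_nat_const leq_mul2r Mr orbT.
Qed.

Lemma hp_value_inhabited (r k : nat) : 0 < r -> exists m, hp_value r k m.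
Proof.
move=> r0; pose H := [set [set: 'I_r]].
exists (cover_number H); exists 'I_r, id, H.
have one i (S : {set 'I_r}) : S = setT -> #|[set v in S | v == i]| = 1.
  move=> ->; rewrite -(cards1 i); congr #|pred_of_set _|; apply/setP => j; by rewrite !inE.
split=> //.
- by move=> e /set1P->; rewrite cardsT card_ord.
- by move=> e /set1P eT i; apply: one.
- move=> H' H'H _; exists setT; split=> [|i]; last exact: one.
  apply/forall_inP => e /(subsetP H'H)/set1P->; rewrite setTI.
  by apply/set0Pn; exists (Ordinal r0).
Qed.

Lemma hp_max_exists (r k : nat) : 0 < r -> r < k -> exists h, hp_max r k h.
Proof.
move=> r0 rk; pose P m := `[< hp_value r k m >].
have exP : exists m, P m.
  by have [m hm] := hp_value_inhabited k r0; exists m; apply/asboolP.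
have leP m : P m -> m <= r * r by move/asboolP/(hp_value_bounded r0 rk).
exists (ex_maxn exP leP); case: ex_maxnP => h /asboolP hh hmax.
by split=> // m mv; apply/hmax/asboolP.
Qed.

Lemma hpE (R : realType) (r k h : nat) : hp_max r k h -> hp R r k = h%:R%:E.
Proof.
move=> [hv hmax]; rewrite /hp; case: pselect => [ex|[]]; last by exists h.
case: cid => h' [hv' hmax'] /=; congr (_%:R%:E)%R.
by apply/eqP; rewrite eqn_leq hmax // hmax'.
Qed.

(** * Covering by components: the deterministic upper bound *)

Lemma adj_sym (V : finType) (F : {set {set V}}) : symmetric (adj F).
Proof. by move=> x y; rewrite /adj setUC. Qed.

Lemma connect_adj_sym (V : finType) (F : {set {set V}}) : connect_sym (adj F).
Proof. exact/sym_connect_sym/adj_sym. Qed.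

(** A walk that never visits x cannot use an edge at x. *)
Lemma path_avoiding (V : finType) (F : {set {set V}}) (x y z : V) (s : seq V) :
  x \notin z :: s -> path (adj F) z s -> path (adj (F :\ [set x; y])) z s.
Proof.
elim: s z => //= u s IH z; rewrite inE negb_or => /andP[xz xs] /andP[zu us].
rewrite IH // andbT /adj in_setD1 -/(adj F z u) zu andbT; apply: contra xs => /eqP/setP/(_ x).
by rewrite !inE eqxx (negbTE xz) /= => /eqP->; rewrite eqxx.
Qed.

(** The rest of the cycle is a walk from y back to x avoiding the edge xy. *)
Lemma cycle_edge_redundant (V : finType) (F : {set {set V}}) (x y : V) (s : seq V) :
  0 < size s -> ucycle (adj F) [:: x, y & s] ->
  connect (adj (F :\ [set x; y])) x y.
Proof.
case: s => [//|z s] _ /andP[] /=; rewrite rcons_path.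
move=> /and4P[xy yz zs lx] /and3P[xys yzs _].
rewrite connect_adj_sym; apply/connectP; exists (rcons (z :: s) x); last by rewrite last_rcons.
have yx : y != x by apply: contraNneq xys => ->; rewrite inE eqxx.
have xzs : x \notin z :: s by move: xys; rewrite inE negb_or => /andP[].
rewrite rcons_path (path_avoiding y xys) /= ?yz //.
rewrite /adj in_setD1 -/(adj F (last z s) x) lx andbT; apply: contraNneq yzs => /setP/(_ y).
rewrite !inE eqxx orbT (negbTE yx) orbF => /eqP->.
by rewrite -in_cons mem_last.
Qed.

(** A smallest edge set connecting W is acyclic, because an edge of a cycle
    could be removed. *)
Lemma spanning_tree (V : finType) (W : {set V}) (F : {set {set V}}) :
  connected_graph W F -> exists2 F' : {set {set V}}, F' \subset F & is_tree W F'.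
Proof.
move=> WF.
pose Q := [pred F' : {set {set V}} | (F' \subset F) && `[< connected_graph W F' >]].
have QF : Q F by rewrite /Q /= subxx; apply/asboolP.
have [F' /andP[F'F /asboolP cF'] minF'] := arg_minnP (fun F' : {set {set V}} => #|F'|) QF.
exists F' => //; split=> // s; case: s => [//|x [//|y s]] /= s2 cyc.
have xyF' : [set x; y] \in F' by case/andP: cyc => /andP[].
have sub : F' :\ [set x; y] \subset F' by apply: subD1set.
(* Every use of the deleted edge is replaced by the rest of the cycle. *)
have : Q (F' :\ [set x; y]).
  rewrite /Q /= (subset_trans sub F'F) /=; apply/asboolP; case: cF' => W0 cW.
  split=> // u v uW vW; have := cW _ _ uW vW; apply: connect_sub => a b ab.
  have cxy : connect (adj (F' :\ [set x; y])) x y by apply: cycle_edge_redundant cyc.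
  have [abxy|abxy] := eqVneq [set a; b] [set x; y]; last first.
    by apply: connect1; rewrite /adj in_setD1 abxy.
  have aE : a \in [set x; y] by rewrite -abxy !inE eqxx.
  have bE : b \in [set x; y] by rewrite -abxy !inE eqxx orbT.
  move: aE bE; rewrite !inE => /orP[]/eqP-> /orP[]/eqP-> //.
  by rewrite connect_adj_sym.
move/minF'; rewrite leqNgt => /negP; apply.
by rewrite [ltnRHS](cardsD1 [set x; y]) xyF'.
Qed.

Definition colour_class (V : finType) (G : sgraph V) (s : nat)
    (c : {set V} -> 'I_s) (i : 'I_s) : {set {set V}} :=
  [set e in edges G | c e == i].

Lemma component_tree (V : finType) (G : sgraph V) (s : nat)
    (c : {set V} -> 'I_s) (i : 'I_s) (x : V) :
  exists2 T, mono_tree G c T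
    & forall y, connect (adj (colour_class G c i)) x y -> y \in T.1.
Proof.
set E := colour_class G c i.
pose W := [set y | connect (adj E) x y].
pose F := [set e in E | e \subset W].
have xW : x \in W by rewrite inE connect0.
have pathW y p : y \in W -> path (adj E) y p -> path (adj F) y p.
  elim: p y => //= z p IH y yW /andP[yz zp].
  have zW : z \in W by move: yW; rewrite !inE => /connect_trans; apply; apply: connect1.
  by rewrite IH // andbT /adj inE -/(adj E y z) yz subUset !sub1set yW.
have conF y : y \in W -> connect (adj F) x y.
  rewrite inE => /connectP[p pE ->]; apply/connectP; exists p => //.
  exact: pathW.
have WF : connected_graph W F.
  split=> [|y z yW zW]; first by apply/set0Pn; exists x.
  apply: connect_trans (conF _ zW); rewrite connect_adj_sym; exact: conF.
have [F' F'F tF'] := spanning_tree WF.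
exists (W, F') => [|y xy]; last by rewrite inE.
have F'E e : e \in F' -> [/\ e \in edges G, c e = i & e \subset W].
  by move=> /(subsetP F'F); rewrite !inE => /andP[/andP[-> /eqP->] ->].
split=> //=.
- by split=> [|e /F'E[] //]; apply/subsetP => e /F'E[].
- by move=> e f /F'E[_ -> _] /F'E[_ -> _].
Qed.

Section ComponentHypergraph.
Variables (V : finType) (G : sgraph V) (r : nat) (c : {set V} -> 'I_r).

(** The i-th component of v is encoded by its canonical root, tagged by i so
    that the parts are disjoint. *)
Definition component_edge (v : V) : {set 'I_r * V} :=
  [set (i, root (adj (colour_class G c i)) v) | i : 'I_r].

Definition component_hypergraph : {set {set 'I_r * V}} :=
  [set component_edge v | v : V].

Lemma component_edge_part v i :
  [set x in component_edge v | x.1 == i]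
    = [set (i, root (adj (colour_class G c i)) v)].
Proof.
apply/setP => -[j u]; rewrite !inE /=; apply/andP/eqP => [[/imsetP[i' _ [-> ->]] /eqP->]//|].
by case=> -> ->; split=> //; apply: imset_f.
Qed.

Lemma component_uniform : uniform r component_hypergraph.
Proof.
move=> _ /imsetP[v _ ->]; rewrite card_imset ?card_ord //.
by move=> i j [].
Qed.

Lemma component_partite : partite fst component_hypergraph.
Proof. by move=> _ /imsetP[v _ ->] i; rewrite component_edge_part cards1. Qed.

(** The edge of a common neighbour w is the transversal cover: w and v lie in
    the same component of the colour of the edge wv. *)
Lemma component_covering (k : nat) (v0 : V) :
  (forall t : 'I_k -> V, exists w, forall a, [set w; t a] \in edges G) ->
  covering_property k fst component_hypergraph.
Proof.
move=> nbr H' H'H H'k.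
pose rep e := odflt v0 [pick v | component_edge v == e].
have repE e : e \in H' -> component_edge (rep e) = e.
  move=> /(subsetP H'H)/imsetP[v _ ->]; rewrite /rep.
  by case: pickP => [u /eqP//|/(_ v)]; rewrite eqxx.
(* H' may have fewer than k members; the remaining entries of the tuple
   represent the edge of v0. *)
have [w wt] := nbr (fun a => rep (nth (component_edge v0) (enum H') a)).
exists (component_edge w); split=> [|i]; last by rewrite component_edge_part cards1.
apply/forall_inP => e eH'; apply/set0Pn.
have ek : index e (enum H') < k.
  by apply: leq_trans H'k; rewrite cardE index_mem mem_enum.
have /= := wt (Ordinal ek); rewrite nth_index ?mem_enum // => we.
pose i := c [set w; rep e]; pose R := adj (colour_class G c i).
have xw : (i, root R w) \in component_edge w by apply: imset_f.
have wrep : root R w = root R (rep e).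
  apply/eqP; rewrite root_connect; last exact: connect_adj_sym.
  by apply: connect1; rewrite /R /adj inE we eqxx.
have : (i, root R w) \in component_edge (rep e) by rewrite wrep; apply: imset_f.
by rewrite (repE e eH') => xe; exists (i, root R w); rewrite inE xw.
Qed.

Lemma component_cover_trees (S : {set 'I_r * V}) :
  is_cover component_hypergraph S ->
  exists Ts : {set {set V} * {set {set V}}},
    [/\ #|Ts| <= #|S|, forall T, T \in Ts -> mono_tree G c T
      & forall v, exists2 T, T \in Ts & v \in T.1].
Proof.
move=> /forall_inP cS.
have /choice[t tP] : forall x : 'I_r * V, exists T, mono_tree G c T /\
    forall y, connect (adj (colour_class G c x.1)) x.2 y -> y \in T.1.
  by move=> x; have [T mT T1] := component_tree G c x.1 x.2; exists T.
exists (t @: S); split; first exact: leq_imset_card.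
  by move=> _ /imsetP[x _ ->]; case: (tP x).
move=> v; have /set0Pn[x /setIP[xS /imsetP[i _ xE]]] : S :&: component_edge v != set0.
  by apply/cS/imset_f.
exists (t x); first exact: imset_f.
case: (tP x) => _; apply; rewrite xE /= -root_connect; last exact: connect_adj_sym.
by rewrite root_root //; apply: connect_adj_sym.
Qed.
End ComponentHypergraph.

Lemma tc_le (V : finType) (s m : nat) (G : sgraph V) :
  tree_coverable s G m -> tc s G <= m.
Proof.
by move=> Gm; rewrite /tc; case: ex_minnP => t _; apply; apply/asboolP.
Qed.

Lemma tc_coverable (V : finType) (s : nat) (G : sgraph V) :
  tree_coverable s G (tc s G).
Proof. by rewrite /tc; case: ex_minnP => t /asboolP. Qed.

(** For each colouring the component hypergraph competes in the definition of
    hp_r(k), and a minimum cover of it is a covering family of components. *)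
Lemma tc_le_hp (V : finType) (v0 : V) (r k h : nat) (G : sgraph V) :
  0 < r -> hp_max r k h ->
  (forall t : 'I_k -> V, exists w, forall a, [set w; t a] \in edges G) ->
  tc r G <= h.
Proof.
move=> r0 [_ hmax] nbr; apply: tc_le => c.
have [S cS SE] := cover_number_witness r0 (@component_uniform _ G _ c).
have [Ts [TsS mTs cTs]] := component_cover_trees cS.
exists Ts; split=> //; apply: leq_trans TsS _; rewrite SE; apply: hmax.
exists ('I_r * V)%type, fst, (component_hypergraph G c); split=> //.
- exact: component_uniform.
- exact: component_partite.
- exact: component_covering.
Qed.

(** * Colouring around an independent set: the deterministic lower bound *)

Lemma connect_adj_neq (V : finType) (F : {set {set V}}) (x y : V) :
  connect (adj F) x y -> x != y -> exists u, [set x; u] \in F.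
Proof.
move=> /connectP[[|u s] /=]; first by move=> _ ->; rewrite eqxx.
by move=> /andP[xu _] _ _; exists u.
Qed.

Lemma connect_invariant (V : finType) (e : rel V) (P : V -> Prop) (x y : V) :
  (forall a b, e a b -> P a -> P b) -> connect e x y -> P x -> P y.
Proof.
move=> eP /connectP[s + ->]; elim: s x => //= u s IH x /andP[xu us] Px.
by apply: IH us _; apply: eP Px.
Qed.

Section LowerColouring.
Variables (V VH : finType) (G : sgraph V) (r : nat) (part : VH -> 'I_r)
  (H : {set {set VH}}) (f : {set VH} -> V).
Hypothesis uH : uniform r H.
Hypothesis pH : partite part H.
Hypothesis f_inj : {in H &, injective f}.
Hypothesis f_indep : forall e e', e \in H -> e' \in H -> [set f e; f e'] \notin edges G.

Let attached w := [set e in H | [set f e; w] \in edges G].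

Variable T : V -> {set VH}.
Hypothesis TP : forall w, w \notin f @: H -> transversal_cover part (attached w) (T w).

(** A triple (e, w, x) records that s joins the vertex f e to the outside
    vertex w, and that x witnesses that T w meets e. *)
Definition triple_for (s : {set V}) (t : {set VH} * V * VH) : bool :=
  let: (e, w, x) := t in
  [&& e \in H, w \notin f @: H, s == [set f e; w] & x \in T w :&: e].

(** The colour ord_max plays the part of colour r + 1; the other r colours
    are the parts of H. *)
Definition lower_colour (s : {set V}) : 'I_r.+1 :=
  if [pick t | triple_for s t] is Some t then widen_ord (leqnSn r) (part t.2)
  else ord_max.

Lemma lower_colour_max s : (lower_colour s != ord_max) ->
  exists e w, [/\ e \in H, w \notin f @: H & s = [set f e; w]].
Proof.
rewrite /lower_colour; case: pickP => [[[e w] x] /and4P[eH wH /eqP-> _] _|_].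
  by exists e, w.
by rewrite eqxx.
Qed.

(** The pair (e, w) is determined by the set {f e, w}, so whichever triple is
    picked is a triple for e and w. *)
Lemma lower_colour_edge e w : e \in H -> w \notin f @: H ->
  [set f e; w] \in edges G ->
  exists2 x, lower_colour [set f e; w] = widen_ord (leqnSn r) (part x)
    & x \in T w :&: e.
Proof.
move=> eH wH ew; rewrite /lower_colour; case: pickP => [[[e' w'] x]|].
  move=> /and4P[eH' wH' /eqP E xTe] /=; exists x => //.
  have : f e' \in [set f e; w] by rewrite E !inE eqxx.
  have : w' \in [set f e; w] by rewrite E !inE eqxx orbT.
  rewrite !inE => /orP[/eqP w'e|/eqP w'w].
    by move: wH'; rewrite w'e imset_f.
  move=> /orP[/eqP ee|/eqP we]; last by move: wH; rewrite -we imset_f.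
  by move: xTe; rewrite inE w'w (f_inj eH' eH ee).
case: (TP wH) => /forall_inP/(_ e); rewrite inE eH => /(_ ew)/set0Pn[x xTe] _.
by move=> /(_ (e, w, x)); rewrite /= eH wH eqxx xTe.
Qed.

Lemma widen_neq_max (i : 'I_r) : widen_ord (leqnSn r) i != ord_max.
Proof. by rewrite -val_eqE /= neq_ltn ltn_ord. Qed.

Lemma partite_inj e : e \in H -> {in e &, injective part}.
Proof. by move=> eH; apply: transversal_inj => i; apply: pH. Qed.

(** A tree containing some f e acts on H as one vertex x.  Its colour i is the
    part of a vertex x common to e0 and T u, where u is a neighbour of f e0 in
    the tree.  Any
    edge of that colour joins an outside w to some f e where T w and e agree in
    part i; as T w and e have one vertex in part i each, membership of x
    propagates along the tree. *)
Lemma tree_vertex (W : {set V}) (F : {set {set V}}) e0 :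
  0 < r -> mono_tree G lower_colour (W, F) -> e0 \in H -> f e0 \in W ->
  exists x, forall e, e \in H -> f e \in W -> x \in e.
Proof.
move=> r0 [[/subsetP FG FW] [[_ cWF] _] mono] e0H fe0W.
have [x0 x0e0] : exists x, x \in e0.
  by apply/set0Pn; rewrite -card_gt0 (uH e0H).
(* A tree containing only f e0 may be a single vertex without a colour; then
   any vertex of e0 works. *)
have [/exists_inP[e eH /andP[feW ee0]]|/exists_inPn alone] :=
  boolP [exists e in H, (f e \in W) && (e != e0)]; last first.
  exists x0 => e eH feW; have := alone e eH; rewrite feW /= negbK => /eqP->.
  exact: x0e0.
have [u fe0u] : exists u, [set f e0; u] \in F.
  apply: connect_adj_neq (cWF _ _ fe0W feW) _.
  by apply: contra ee0 => /eqP/(f_inj e0H eH)->.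
have uH' : u \notin f @: H.
  apply/negP => /imsetP[e' e'H uE]; have := f_indep e0H e'H.
  by rewrite -uE (FG _ fe0u).
have [x xc /setIP[xT xe0]] := lower_colour_edge e0H uH' (FG _ fe0u).
exists x => e' e'H fe'W.
pose P v := forall e', e' \in H -> v = f e' -> x \in e'.
pose P' v := v \notin f @: H -> x \in T v.
suff : P (f e') /\ P' (f e') by case=> /(_ e' e'H erefl).
have Pe0 : P (f e0) /\ P' (f e0).
  split; first by move=> e1 e1H /(f_inj e0H e1H) <-.
  by rewrite /P' imset_f.
apply: (connect_invariant (P := fun v => P v /\ P' v) _ (cWF _ _ fe0W fe'W) Pe0) => a b ab [Pa P'a].
have abG := FG _ ab.
have cab : lower_colour [set a; b] = widen_ord (leqnSn r) (part x).
  by rewrite -xc; apply: mono.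
have same y : lower_colour [set a; b] = widen_ord (leqnSn r) (part y) ->
    part x = part y.
  by rewrite cab => /(congr1 val) /= xy; apply: val_inj.
have [aH|aH] := boolP (a \in f @: H).
  have [e1 e1H aE] := imsetP aH.
  have bH : b \notin f @: H.
    by apply/negP => /imsetP[e2 e2H bE]; have := f_indep e1H e2H; rewrite -aE -bE abG.
  split=> [e2 e2H bE|_]; first by move: bH; rewrite bE imset_f.
  move: abG same; rewrite aE => abG same.
  have [y yc /setIP[yT ye1]] := lower_colour_edge e1H bH abG.
  by rewrite (partite_inj e1H (Pa _ e1H aE) ye1 (same _ yc)).
have [bH|bH] := boolP (b \in f @: H).
  have [e1 e1H bE] := imsetP bH.
  split=> [e2 e2H bE2|]; last by rewrite /P' bH.
  have {e1 e1H bE} bE1 := bE2.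
  move: abG same; rewrite setUC bE2 => abG same.
  have [y yc /setIP[yT ye2]] := lower_colour_edge e2H aH abG.
  have [_ tT] := TP aH.
  by rewrite (transversal_inj tT (P'a aH) yT (same _ yc)).
have := lower_colour_max (s := [set a; b]).
rewrite cab widen_neq_max => /(_ isT)[e1 [w [e1H wH E]]].
have : f e1 \in [set a; b] by rewrite E !inE eqxx.
by rewrite !inE => /orP[]/eqP fe1; [move: aH|move: bH]; rewrite -fe1 imset_f.
Qed.

(** The vertex w0 sees no f e, so its tree has the extra colour unless it is
    a single vertex; no edge at any f e has that colour. *)
Lemma tree_outside (W : {set V}) (F : {set {set V}}) w0 e :
  mono_tree G lower_colour (W, F) -> w0 \notin f @: H ->
  (forall e, e \in H -> [set f e; w0] \notin edges G) ->
  w0 \in W -> e \in H -> f e \notin W.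
Proof.
move=> [[/subsetP FG FW] [[_ cWF] _] mono] w0H w0far w0W eH; apply/negP => feW.
have cw := cWF _ _ w0W feW.
have [u w0u] : exists u, [set w0; u] \in F.
  apply: connect_adj_neq cw _; apply: contraNneq w0H => ->; exact: imset_f.
have c0 : lower_colour [set w0; u] = ord_max.
  apply/eqP; apply: contraT => /lower_colour_max[e1 [w [e1H wH E]]].
  have fe1 : f e1 \in [set w0; u] by rewrite E !inE eqxx.
  move: fe1; rewrite !inE => /orP[]/eqP fe1; first by move: w0H; rewrite -fe1 imset_f.
  by have := w0far _ e1H; rewrite fe1 setUC (FG _ w0u).
suff : f e \notin f @: H by rewrite imset_f.
apply: (connect_invariant (P := fun v => v \notin f @: H) _ cw w0H) => a b ab aH.
apply/negP => /imsetP[e1 e1H bE].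
have e1a : [set f e1; a] \in edges G by rewrite -bE setUC; apply: FG.
have [y yc _] := lower_colour_edge e1H aH e1a.
have := widen_neq_max (part y); rewrite -yc -bE setUC -c0.
by rewrite (mono _ _ ab w0u) eqxx.
Qed.

End LowerColouring.

(** The trees other than the one containing w0 yield a cover of H with one
    vertex for each tree. *)
Lemma tc_gt_cover_number (V VH : finType) (G : sgraph V) (r k : nat)
    (part : VH -> 'I_r) (H : {set {set VH}}) (f : {set VH} -> V) (w0 : V) :
  0 < r -> uniform r H -> partite part H -> covering_property k part H ->
  {in H &, injective f} ->
  (forall e e', e \in H -> e' \in H -> [set f e; f e'] \notin edges G) ->
  (forall w, w \notin f @: H -> #|[set e in H | [set f e; w] \in edges G]| <= k) ->
  w0 \notin f @: H -> (forall e, e \in H -> [set f e; w0] \notin edges G) ->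
  cover_number H < tc r.+1 G.
Proof.
move=> r0 uH pH cH f_inj f_indep f_deg w0H w0far.
have /choice[T TP] : forall w, exists S, w \notin f @: H ->
    transversal_cover part [set e in H | [set f e; w] \in edges G] S.
  move=> w; have [wH|wH] := boolP (w \in f @: H); first by exists set0.
  have [|//|S ST] := cH [set e in H | [set f e; w] \in edges G]; last by exists S.
  - by apply/subsetP => e; rewrite inE => /andP[].
  - exact: f_deg.
have [Ts [TsS mTs cTs]] := tc_coverable G (lower_colour part H f T).
apply: leq_trans TsS.
have [[W0 F0] T0s w0W0] := cTs w0.
have far0 e : e \in H -> f e \notin W0.
  exact: (tree_outside f_inj TP (mTs _ T0s) w0H w0far w0W0).
have /choice[x xP] : forall A : {set V} * {set {set V}}, exists x : option VH,
    A \in Ts -> forall e, e \in H -> f e \in A.1 -> exists2 y, x = Some y & y \in e.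
  move=> [W F].
  have [As|As] := boolP ((W, F) \in Ts); last by exists None.
  have [/exists_inP[e0 e0H fe0]|/exists_inPn none] := boolP [exists e in H, f e \in W].
    have [y yP] := tree_vertex uH pH f_inj f_indep TP r0 (mTs _ As) e0H fe0.
    by exists (Some y) => _ e eH /= feW; exists y => //; apply: yP.
  by exists None => _ e eH /= feW; have := none e eH; rewrite feW.
pose S := [set y | Some y \in x @: (Ts :\ (W0, F0))].
have cS : is_cover H S.
  apply/forall_inP => e eH; apply/set0Pn.
  have [A As feA] := cTs (f e); have [y xA ye] := xP _ As _ eH feA.
  exists y; rewrite !inE ye andbT -xA; apply: imset_f; rewrite in_setD1 As andbT.
  by apply: contraTneq feA => ->; apply: far0.
apply: leq_ltn_trans (cover_number_le cS) _.
rewrite (cardsD1 (W0, F0) Ts) T0s add1n ltnS.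
apply: leq_trans (leq_imset_card x _).
rewrite -(card_imset S (@Some_inj _)); apply/subset_leq_card/fintype.subsetP.
by move=> _ /imsetP[y + ->]; rewrite inE.
Qed.

(** * Random subsets with independent elements *)

Local Open Scope ring_scope.

Section RandomSubset.
Variables (R : realType) (T : finType) (q : T -> R).

(** The probability of the outcome F when each e is selected independently
    with its own probability q e.  Taking q = 0 outside the pairs of vertices
    gives the binomial random graph without a restriction on F. *)
Definition rs_weight (F : {set T}) : R :=
  \prod_e (if e \in F then q e else 1 - q e).

Definition expect (f : {set T} -> R) : R := \sum_F rs_weight F * f F.

Definition prob (A : pred {set T}) : R := expect (fun F => (A F)%:R).

(** Functions measurable with respect to the coordinates in D. *)
Definition local_to (D : {set T}) (S : Type) (f : {set T} -> S) : Prop :=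
  forall F F', F :&: D = F' :&: D -> f F = f F'.

Lemma expect1 : expect (fun=> 1) = 1.
Proof.
rewrite /expect; under eq_bigr do rewrite mulr1.
transitivity (\prod_e (q e + (1 - q e))); last first.
  by rewrite big1 // => e _; rewrite addrC subrK.
by rewrite bigA_distr.
Qed.

Lemma eq_expect f g : f =1 g -> expect f = expect g.
Proof. by move=> fg; apply: eq_bigr => F _; rewrite fg. Qed.

Lemma eq_prob A B : A =1 B -> prob A = prob B.
Proof. by move=> AB; apply: eq_expect => F; rewrite AB. Qed.

(** Independence of functions of disjoint coordinates.  Swapping the
    coordinates outside D between two independent copies F, F' preserves the
    joint weight, and it turns f(F) g(F') into f(F) g(F). *)
Lemma expectM (D : {set T}) f g :
  local_to D f -> local_to (~: D) g ->
  expect (fun F => f F * g F) = expect f * expect g.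
Proof.
move=> fD gD; pose mix (X Y : {set T}) := (X :&: D) :|: (Y :\: D).
have mixD X Y : mix X Y :&: D = X :&: D.
  by apply/setP => e; rewrite !inE; case: (e \in D); rewrite ?andbF ?orbF ?andbT.
have mixC X Y : mix X Y :&: ~: D = Y :&: ~: D.
  by apply/setP => e; rewrite !inE; case: (e \in D); rewrite ?andbF ?orbF ?andbT.
pose swap (P : {set T} * {set T}) := (mix P.1 P.2, mix P.2 P.1).
have swapK : involutive swap.
  move=> [X Y]; congr (_, _); apply/setP => e; rewrite !inE /=;
    by case: (e \in D); rewrite ?andbF ?orbF ?andbT ?orbT.
rewrite -[LHS]mulr1 -expect1 /expect !big_distrlr /= !pair_big /=.
rewrite [RHS](reindex_inj (inv_inj swapK)) /=; apply: eq_bigr => -[X Y] _ /=.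
rewrite mulr1 (fD (mix X Y) X) ?mixD // (gD (mix Y X) X) ?mixC //.
have -> : rs_weight (mix X Y) * f X * (rs_weight (mix Y X) * g X)
        = (rs_weight (mix X Y) * rs_weight (mix Y X)) * (f X * g X).
  by rewrite mulrACA.
rewrite [LHS]mulrAC; congr (_ * _); rewrite /rs_weight -!big_split /=.
apply: eq_bigr => e _; rewrite !inE.
by case: (e \in D); rewrite ?andbF ?orbF ?andbT ?orbT //= mulrC.
Qed.

Lemma local_toW (D D' : {set T}) (S : Type) (f : {set T} -> S) :
  D \subset D' -> local_to D f -> local_to D' f.
Proof.
move=> DD' fD F F' E; apply: fD.
by rewrite -(setIidPr DD') !setIA E.
Qed.

Lemma expect_prod (I : eqType) (s : seq I) (D : I -> {set T}) (f : I -> {set T} -> R) :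
  uniq s -> {in s &, forall i j, i != j -> [disjoint D i & D j]} ->
  (forall i, local_to (D i) (f i)) ->
  expect (fun F => \prod_(i <- s) f i F) = \prod_(i <- s) expect (f i).
Proof.
move=> + + fD; elim: s => [|i s IH] /=.
  by move=> _ _; under eq_expect do rewrite big_nil; rewrite expect1 big_nil.
move=> /andP[is_ us] dis; under eq_expect do rewrite big_cons.
rewrite (expectM (fD i)) ?big_cons ?IH //.
  by move=> j l js ls; apply: dis; rewrite inE ?js ?ls orbT.
move=> F F' E; apply: eq_big_seq => j js.
have Dj : D j \subset ~: D i.
  rewrite -disjoints_subset; apply: dis; rewrite ?inE ?js ?eqxx ?orbT //.
  by apply: contraNneq is_ => <-.
exact: local_toW Dj (fD j) _ _ E.
Qed.

Lemma local_to_nat (D : {set T}) (A : pred {set T}) :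
  local_to D A -> local_to D (fun F => (A F)%:R : R).
Proof. by move=> AD F F' E; rewrite (AD F F'). Qed.

Lemma prob_forall (I : finType) (P : pred I) (D : I -> {set T}) (A : I -> pred {set T}) :
  (forall i j, P i -> P j -> i != j -> [disjoint D i & D j]) ->
  (forall i, local_to (D i) (A i)) ->
  prob (fun F => [forall (i | P i), A i F]) = \prod_(i | P i) prob (A i).
Proof.
move=> dis AD.
have enumP (f : I -> R) : \prod_(i | P i) f i = \prod_(i <- enum P) f i.
  by rewrite big_enum.
rewrite enumP -(expect_prod (D := D)) ?enum_uniq //; first last.
- by move=> i; apply/local_to_nat/AD.
- by move=> i j; rewrite !mem_enum; apply: dis.
apply: eq_expect => F; rewrite -enumP.
have [/forall_inP AF|/forall_inPn[i Pi AiF]] := boolP [forall (i | P i), A i F].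
  by rewrite big1 // => i /AF->.
by rewrite (bigD1 i) //= (negbTE AiF) mul0r.
Qed.

(** Multiplying the factor of e for non-selection by 0 turns the sum over the
    outcomes containing e into an unrestricted one, which factorises. *)
Lemma prob_mem e : prob (fun F => e \in F) = q e.
Proof.
rewrite /prob /expect.
transitivity (\sum_(F : {set T}) \prod_e'
    (if e' \in F then q e' else (e' != e)%:R * (1 - q e'))).
  apply: eq_bigr => F _; have [eF|eF] := boolP (e \in F).
    rewrite mulr1; apply: eq_bigr => e' _; case: ifPn => // e'F.
    by have [ee|] := eqVneq e' e; rewrite ?mul1r //; rewrite ee eF in e'F.
  by rewrite mulr0 (bigD1 e) //= (negbTE eF) eqxx !mul0r.
rewrite -(bigA_distr _ _ q (fun e' => (e' != e)%:R * (1 - q e'))).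
rewrite (bigD1 e) //= eqxx mul0r addr0 big1 ?mulr1 // => e' ->.
by rewrite mul1r addrC subrK.
Qed.

Lemma prob_subset (E : {set T}) : prob (fun F => E \subset F) = \prod_(e in E) q e.
Proof.
under eq_bigr do rewrite -prob_mem.
rewrite -(prob_forall (D := fun e => [set e]) (A := fun e F => e \in F)).
- apply: eq_prob => F; apply/fintype.subsetP/forall_inP => EF e; exact: EF.
- by move=> e e' _ _ ee'; rewrite disjoints1 inE.
- by move=> e F F' /setP/(_ e); rewrite !inE eqxx !andbT.
Qed.

Lemma probC A : prob (fun F => ~~ A F) = 1 - prob A.
Proof.
rewrite -expect1 /prob /expect -sumrB; apply: eq_bigr => F _.
by case: (A F); rewrite ?mulr0 ?mulr1 ?subrr ?subr0.
Qed.

Hypothesis q01 : forall e, 0 <= q e <= 1.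

Lemma rs_weight_ge0 F : 0 <= rs_weight F.
Proof.
apply: prodr_ge0 => e _; case/andP: (q01 e) => q0 q1.
by case: ifP; rewrite ?subr_ge0.
Qed.

Lemma le_expect f g : (forall F, f F <= g F) -> expect f <= expect g.
Proof. by move=> fg; apply: ler_sum => F _; rewrite ler_wpM2l ?rs_weight_ge0. Qed.

Lemma le_prob (A B : pred {set T}) : (forall F, A F -> B F) -> prob A <= prob B.
Proof.
move=> AB; apply: le_expect => F; rewrite ler_nat.
by case: (A F) (AB F) => // ->.
Qed.

Lemma prob_ge0 A : 0 <= prob A.
Proof. by apply: sumr_ge0 => F _; rewrite mulr_ge0 ?rs_weight_ge0. Qed.

Lemma prob_le1 A : prob A <= 1.
Proof. by rewrite -expect1; apply: le_expect => F; rewrite lern1 leq_b1. Qed.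

Lemma prob_exists (I : finType) (P : pred I) (A : I -> pred {set T}) :
  prob (fun F => [exists (i | P i), A i F]) <= \sum_(i | P i) prob (A i).
Proof.
rewrite /prob /expect exchange_big /=; apply: ler_sum => F _.
rewrite -mulr_sumr ler_wpM2l ?rs_weight_ge0 //.
have [/exists_inP[i Pi AiF]|_] := boolP [exists (i | P i), A i F]; last first.
  by apply: sumr_ge0.
by rewrite (bigD1 i) //= AiF lerDl sumr_ge0.
Qed.

Lemma prob_existsT (I : finType) (A : I -> pred {set T}) :
  prob (fun F => [exists i, A i F]) <= \sum_i prob (A i).
Proof. exact: (prob_exists xpredT A). Qed.

End RandomSubset.

Section Gnp.
Variables (R : realType) (n : nat) (p : R).
Hypothesis p01 : 0 <= p <= 1.

Definition pair_prob (e : {set 'I_n}) : R := if e \in pairs 'I_n then p else 0.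

Lemma pair_prob01 e : 0 <= pair_prob e <= 1.
Proof. by rewrite /pair_prob; case: ifP => _; rewrite ?p01 ?lexx ?ler01. Qed.

Lemma pair_prob_le e : pair_prob e <= p.
Proof. by rewrite /pair_prob; case: ifP => // _; case/andP: p01. Qed.

(** Outcomes that are not sets of pairs have weight 0. *)
Lemma gnp_probE (A : pred (sgraph 'I_n)) (B : pred {set {set 'I_n}}) :
  (forall G, A G = B (edges G)) -> gnp_prob p A = prob pair_prob B.
Proof.
move=> AB; rewrite /gnp_prob /prob /expect.
rewrite [RHS](bigID (fun F : {set {set 'I_n}} => F \subset pairs 'I_n)) /= [X in _ + X]big1 ?addr0; last first.
  move=> F /subsetPn[e eF eP].
  by rewrite /rs_weight (bigD1 e) //= eF /pair_prob (negbTE eP) !mul0r.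
rewrite (reindex_omap (@edges 'I_n) insub) /=; last first.
  by move=> F FP; rewrite insubT.
rewrite big_mkcond [RHS]big_mkcond; apply: eq_bigr => G _.
rewrite edges_pairs (valK G) eqxx /= AB; case: (B _); rewrite ?mulr0 // mulr1.
rewrite /gnp_weight /rs_weight big_mkcond /=; apply: eq_bigr => e _.
rewrite /pair_prob; case: ifPn => // eP; case: ifPn => [eG|_]; last by rewrite subr0.
by move: eP; rewrite (fintype.subsetP (edges_pairs G)).
Qed.

End Gnp.

(** * Stars and blocks in the binomial random graph *)

Section Stars.
Variable V : finType.

Definition star (S : {set V}) (w : V) : {set {set V}} := [set [set v; w] | v in S].

Lemma star_center (S : {set V}) (w : V) (e : {set V}) :
  w \notin S -> e \in star S w -> e \subset w |: S /\ w \in e.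
Proof.
move=> wS /imsetP[v vS ->]; rewrite !inE eqxx orbT; split=> //.
by rewrite setUC setUS // sub1set.
Qed.

Lemma card_star (S : {set V}) (w : V) : w \notin S -> #|star S w| = #|S|.
Proof.
move=> wS; apply: card_in_imset => v v' vS v'S /setP/(_ v).
rewrite !inE eqxx /= => /esym/orP[/eqP//|/eqP vw].
by move: wS; rewrite -vw vS.
Qed.

Lemma star_pairs (S : {set V}) (w : V) : w \notin S -> star S w \subset pairs V.
Proof.
move=> wS; apply/fintype.subsetP => _ /imsetP[v vS ->]; rewrite inE cards2.
by case: (v =P w) => // vw; move: wS; rewrite -vw vS.
Qed.

Lemma star_disjoint_centers (S : {set V}) (w w' : V) :
  w \notin S -> w' \notin S -> w != w' -> [disjoint star S w & star S w'].
Proof.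
move=> wS w'S ww'; rewrite -setI_eq0; apply/eqP/setP => e; rewrite !inE.
apply/negP => /andP[/(star_center wS)[/fintype.subsetP sub _] /(star_center w'S)[_ w'e]].
by have := sub _ w'e; rewrite !inE (negbTE w'S) orbF eq_sym (negbTE ww').
Qed.

End Stars.

Section GnpEvents.
Variables (R : realType) (n : nat) (p : R).
Hypothesis p01 : 0 <= p <= 1.
Let q := @pair_prob R n p.
Let q01 : forall e, 0 <= q e <= 1 := pair_prob01 p01.

Lemma prob_star (S : {set 'I_n}) (w : 'I_n) :
  w \notin S -> prob q (fun F => star S w \subset F) = p ^+ #|S|.
Proof.
move=> wS; rewrite prob_subset -(card_star wS) -prodr_const.
apply: eq_bigr => e /(fintype.subsetP (star_pairs wS)) eP.
by rewrite /q /pair_prob eP.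
Qed.

Lemma local_to_star (S : {set 'I_n}) (w : 'I_n) (A : pred {set 'I_n}) :
  local_to (star S w) (fun F => A [set v in S | [set v; w] \in F]).
Proof.
move=> F F' E; congr A; apply/setP => v; rewrite !inE.
have [vS|//] := boolP (v \in S).
have /setP/(_ [set v; w]) := E; rewrite !inE.
have -> : [set v; w] \in star S w by apply: imset_f.
by rewrite !andbT.
Qed.

Lemma star_subset (S : {set 'I_n}) (w : 'I_n) (F : {set {set 'I_n}}) :
  (star S w \subset F) = (S \subset [set v in S | [set v; w] \in F]).
Proof.
apply/fintype.subsetP/fintype.subsetP => [sF v vS|sS _ /imsetP[v /sS + ->]].
  by rewrite inE vS sF //; apply: imset_f.
by rewrite inE => /andP[].
Qed.

(** The stars at different centres outside S have disjoint edge sets, so the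
    failures of the n - |S| candidates are independent. *)
Lemma prob_no_common_neighbour (k : nat) (S : {set 'I_n}) :
  (#|S| <= k)%N -> (k <= n)%N ->
  prob q (fun F => [forall (w | w \notin S), ~~ (star S w \subset F)])
    <= (1 - p ^+ k) ^+ (n - k).
Proof.
move=> Sk kn; case/andP: (p01) => p0 p1.
rewrite (prob_forall q (D := star S) (A := fun w F => ~~ (star S w \subset F))).
- under eq_bigr => w wS do rewrite probC prob_star //.
  rewrite prodr_const.
  have pS : p ^+ k <= p ^+ #|S| by apply: ler_wiXn2l.
  have pk : 0 <= 1 - p ^+ k <= 1.
    by rewrite subr_ge0 exprn_ile1 // lerBlDr lerDl exprn_ge0.
  have pS0 : 0 <= 1 - p ^+ #|S| by rewrite subr_ge0 exprn_ile1.
  apply: (@le_trans _ _ ((1 - p ^+ k) ^+ #|[pred w | w \notin S]|)).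
    by apply: lerXn2r; rewrite ?nnegrE //; [case/andP: pk|rewrite lerB].
  case/andP: pk => pk0 pk1; apply: ler_wiXn2l => //.
  have -> : #|[pred w | w \notin S]| = #|~: S| by apply: eq_card => w; rewrite !inE.
  by rewrite [#|~: S|]cardsCs setCK card_ord leq_sub2l.
- by move=> w w' wS w'S; apply: star_disjoint_centers.
- move=> w F F' E; rewrite !star_subset; congr (~~ _).
  exact: (@local_to_star S w (fun X => S \subset X)) E.
Qed.

(** Tuples with repeated entries are included: they cost no more, as fewer
    neighbours are then required. *)
Lemma prob_some_tuple_without_neighbour (k : nat) : (k <= n)%N ->
  prob q (fun F => [exists t : {ffun 'I_k -> 'I_n},
            [forall w, [exists a, [set w; t a] \notin F]]])
    <= n%:R ^+ k * (1 - p ^+ k) ^+ (n - k).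
Proof.
move=> kn; apply: le_trans (prob_existsT q01 _) _.
have -> : n%:R ^+ k * (1 - p ^+ k) ^+ (n - k)
    = \sum_(t : {ffun 'I_k -> 'I_n}) (1 - p ^+ k) ^+ (n - k).
  by rewrite sumr_const card_ffun !card_ord -natrX mulr_natl.
apply: ler_sum => t _; pose S := [set t a | a : 'I_k].
have Sk : (#|S| <= k)%N.
  by rewrite -[X in (_ <= X)%N](card_ord k); apply: leq_imset_card.
apply: le_trans (prob_no_common_neighbour Sk kn).
apply: le_prob => // F /forallP none; apply/forall_inP => w wS.
have /existsP[a ta] := none w; apply/negP => /fintype.subsetP sF.
by move: ta; rewrite setUC sF //; apply: imset_f; apply: imset_f.
Qed.

(** Union bound over the (k+1)-subsets of B that w could see; their number is
    estimated by 2^|B|. *)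
Lemma prob_star_le (B : {set 'I_n}) (k : nat) (w : 'I_n) : w \notin B ->
  1 - (2 ^ #|B|)%:R * p ^+ k.+1
    <= prob q (fun F => (#|[set v in B | [set v; w] \in F]| <= k)%N).
Proof.
move=> wB; case/andP: (p01) => p0 p1.
rewrite lerBlDr -lerBlDl -probC.
pose P (S : {set 'I_n}) := (S \subset B) && (#|S| == k.+1).
apply: (@le_trans _ _ (prob q (fun F => [exists (S | P S), star S w \subset F]))).
  apply: le_prob => // F; rewrite -ltnNge => kF.
  have := kF; rewrite -bin_gt0 -cards_draws => /card_gt0P[S].
  rewrite inE => /andP[SF Sk]; apply/exists_inP; exists S.
    rewrite /P Sk andbT; apply: fintype.subset_trans SF _.
    by apply/fintype.subsetP => v; rewrite inE => /andP[].
  apply/fintype.subsetP => _ /imsetP[v /(fintype.subsetP SF) + ->].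
  by rewrite inE => /andP[].
apply: le_trans (prob_exists q01 _ _) _.
rewrite (eq_bigr (fun=> p ^+ k.+1)); last first.
  move=> S /andP[SB /eqP <-]; apply: prob_star; apply: contra wB.
  exact: fintype.subsetP.
rewrite sumr_const -[leLHS]mulr_natl ler_wpM2r ?exprn_ge0 // ler_nat.
rewrite -card_powerset; apply: subset_leq_card; apply/fintype.subsetP => S.
by rewrite !inE => /andP[].
Qed.

Section Blocks.
Variables (m k : nat) (J : finType) (g : 'I_m * J -> 'I_n).
Hypothesis g_inj : injective g.
Let U := [set g x | x : 'I_m * J].
Let B j := [set g (j, a) | a : J].

(** Only vertices outside the union U of all blocks are tested, which makes
    the events for different blocks depend on disjoint sets of pairs. *)
Definition good_block (F : {set {set 'I_n}}) (j : 'I_m) : bool :=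
  [forall (w | w \notin U), #|[set v in B j | [set v; w] \in F]| <= k]%N.

Lemma block_subset j : B j \subset U.
Proof. by apply/fintype.subsetP => _ /imsetP[a _ ->]; apply: imset_f. Qed.

Lemma block_notin j w : w \notin U -> w \notin B j.
Proof. by apply: contra; apply/fintype.subsetP/block_subset. Qed.

Lemma card_block j : #|B j| = #|J|.
Proof. by rewrite card_imset // => a b /g_inj[]. Qed.

Lemma prob_good_block j :
  (2 ^ #|J|)%:R * p ^+ k.+1 <= 1 ->
  (1 - (2 ^ #|J|)%:R * p ^+ k.+1) ^+ n <= prob q (fun F => good_block F j).
Proof.
move=> y1; case/andP: (p01) => p0 p1.
rewrite (prob_forall q (D := star (B j))
  (A := fun w F => (#|[set v in B j | [set v; w] \in F]| <= k)%N)).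
- set y := 1 - _.
  have y01 : 0 <= y <= 1.
    by rewrite subr_ge0 y1 /y lerBlDr lerDl mulr_ge0 ?exprn_ge0.
  apply: (@le_trans _ _ (\prod_(w | w \notin U) y)).
    rewrite prodr_const; case/andP: y01 => y0 y1'; apply: ler_wiXn2l => //.
    by rewrite -[X in (_ <= X)%N](card_ord n); apply: max_card.
  apply: ler_prod => w wU; case/andP: y01 => -> _ /=.
  by rewrite /y -(card_block j); apply: prob_star_le; apply: block_notin.
- by move=> w w' wU w'U; apply: star_disjoint_centers; apply: block_notin.
- by move=> w; exact: (@local_to_star _ w (fun X => #|X| <= k)%N).
Qed.

Lemma prob_no_good_block :
  (2 ^ #|J|)%:R * p ^+ k.+1 <= 1 ->
  prob q (fun F => [forall j, ~~ good_block F j])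
    <= (1 - (1 - (2 ^ #|J|)%:R * p ^+ k.+1) ^+ n) ^+ m.
Proof.
move=> y1; pose D j := \bigcup_(w | w \notin U) star (B j) w.
rewrite (prob_forall q (P := xpredT) (D := D) (A := fun j F => ~~ good_block F j)).
- rewrite -[X in _ ^+ X](card_ord m) -prodr_const.
  apply: ler_prod => j _; rewrite prob_ge0 //= probC lerB //.
  exact: prob_good_block.
- move=> i j _ _ ij; rewrite -setI_eq0; apply/eqP/setP => e; rewrite !inE.
  apply/negP => /andP[/bigcupP[w wU /imsetP[v vB ->]] /bigcupP[w' w'U /imsetP[v' vB' E]]].
  have : v \in [set v'; w'] by rewrite -E !inE eqxx.
  rewrite !inE => /orP[]/eqP vE; last first.
    by move: (block_notin i w'U); rewrite -vE vB.
  move: vB vB'; rewrite -vE => /imsetP[a _ ->] /imsetP[b _ /g_inj[/eqP]].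
  by rewrite (negbTE ij).
- move=> j F F' E; congr (~~ _); apply: eq_forallb => w.
  have [wU|//] := boolP (w \notin U); congr (_ ==> _).
  apply: (@local_to_star _ w (fun X => #|X| <= k)%N).
  have sD : star (B j) w \subset D j by apply: (bigcup_sup w).
  by rewrite -(setIidPr sD) !setIA E.
Qed.

(** Ordered pairs with equal entries are included; they are never edges. *)
Lemma prob_not_independent :
  prob q (fun F => [exists x : ('I_m * J) * ('I_m * J), [set g x.1; g x.2] \in F])
    <= ((m * #|J|) ^ 2)%:R * p.
Proof.
apply: le_trans (prob_existsT q01 _) _.
apply: (@le_trans _ _ (\sum_(x : ('I_m * J) * ('I_m * J)) p)).
  by apply: ler_sum => x _; rewrite prob_mem; apply: pair_prob_le.
by rewrite sumr_const !card_prod card_ord mulr_natl mulnn.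
Qed.

Lemma prob_bad_blocks :
  (2 ^ #|J|)%:R * p ^+ k.+1 <= 1 ->
  prob q (fun F => [exists x : ('I_m * J) * ('I_m * J), [set g x.1; g x.2] \in F]
                   || [forall j, ~~ good_block F j])
    <= ((m * #|J|) ^ 2)%:R * p + (1 - (1 - (2 ^ #|J|)%:R * p ^+ k.+1) ^+ n) ^+ m.
Proof.
move=> y1; apply: le_trans (lerD prob_not_independent (prob_no_good_block y1)).
rewrite /prob /expect -big_split /=; apply: ler_sum => F _.
rewrite -mulrDr ler_wpM2l ?rs_weight_ge0 //.
by rewrite -natrD ler_nat; case: [exists _, _]; case: [forall _, _].
Qed.

End Blocks.
End GnpEvents.

(** * Estimates and limits *)

Lemma gnp_prob_insub (R : realType) (n : nat) (p : R) (A : pred (sgraph 'I_n)) :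
  gnp_prob p A = prob (@pair_prob R n p)
    (fun F => if insub F is Some G then A G else true).
Proof. by apply: gnp_probE => G; rewrite valK. Qed.

Lemma gnp_prob_ge (R : realType) (n : nat) (p : R) (A : pred (sgraph 'I_n))
    (Bad : pred {set {set 'I_n}}) :
  0 <= p <= 1 -> (forall G, ~~ Bad (edges G) -> A G) ->
  1 - prob (@pair_prob R n p) Bad <= gnp_prob p A.
Proof.
move=> p01 BA; rewrite gnp_prob_insub -probC; apply: le_prob => [|F BF].
  exact: pair_prob01.
by case: insubP => [G _ GF|//]; apply: BA; rewrite GF.
Qed.

Lemma gnp_prob_le1 (R : realType) (n : nat) (p : R) (A : pred (sgraph 'I_n)) :
  0 <= p <= 1 -> gnp_prob p A <= 1.
Proof. by move=> p01; rewrite gnp_prob_insub; apply/prob_le1/pair_prob01. Qed.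

Section Limits.
Local Open Scope classical_set_scope.

Lemma near_ln_ge (R : realType) (a : R) : \forall n \near \oo, a <= ln n%:R.
Proof.
near=> n; have an : expR a <= n%:R by near: n; exact: nbhs_infty_ger.
rewrite -[a]expRK ler_ln ?posrE ?expR_gt0 //.
exact: lt_le_trans (expR_gt0 a) an.
Unshelve. all: by end_near. Qed.

Lemma cvg_expRN_ln (R : realType) (K d : R) : 0 < d ->
  (fun n => K * expR (- (d * ln n%:R))) @ \oo --> (0 : R).
Proof.
move=> d0; rewrite -[X in _ --> X](mulr0 K); apply: cvgMr.
apply: (@cvg_comp _ _ _ (fun n => d * ln n%:R) (fun x => expR (- x)) _
  (pinfty_nbhs R)); last exact: cvgr_expR.
apply/cvgryPge => a; near=> n.
rewrite -ler_pdivrMl //; near: n; exact: near_ln_ge.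
Unshelve. all: by end_near. Qed.

(** The error term K e^(-d log n) = K n^(-d) is the form in which both failure
    probabilities are estimated. *)
Lemma whp_of_bound (R : realType) (p : nat -> R) (K d : R)
    (A : forall n, pred (sgraph 'I_n)) :
  (forall n, 0 <= p n <= 1) -> 0 < d ->
  (\forall n \near \oo, 1 - K * expR (- (d * ln n%:R)) <= gnp_prob (p n) (A n)) ->
  whp p A.
Proof.
move=> p01 d0 bound.
apply: (squeeze_cvgr (f := fun n => 1 - K * expR (- (d * ln n%:R))) (h := fun=> 1)).
- near=> n; rewrite gnp_prob_le1 // andbT; near: n; exact: bound.
- rewrite -[X in _ --> X]subr0; apply: cvgB; first exact: cvg_cst.
  exact: cvg_expRN_ln.
- exact: cvg_cst.
Unshelve. all: by end_near. Qed.

End Limits.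

Lemma expr_1B_le (R : realType) (x : R) (n : nat) :
  x <= 1 -> (1 - x) ^+ n <= expR (- (n%:R * x)).
Proof.
move=> x1; rewrite -mulrN expRM_natl lerXn2r ?nnegrE ?expR_ge0 ?subr_ge0 //.
exact: expR_ge1Dx.
Qed.

(** The exponent is k log n - (n - k) p^k, and replacing n - k by n costs a
    factor e^k at most. *)
Lemma common_neighbour_estimate (R : realType) (k n : nat) (p : R) :
  0 <= p <= 1 -> (0 < n)%N -> (k <= n)%N ->
  k.+1%:R * ln n%:R < n%:R * p ^+ k ->
  n%:R ^+ k * (1 - p ^+ k) ^+ (n - k) <= expR k%:R * expR (- (1 * ln n%:R)).
Proof.
move=> /andP[p0 p1] n0 kn large.
have nE : n%:R = expR (ln n%:R) :> R by rewrite lnK // posrE ltr0n.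
set t := ln n%:R in nE large *.
have x1 : p ^+ k <= 1 by apply: exprn_ile1.
rewrite [X in X ^+ k]nE -expRM_natl -expRD.
apply: le_trans (ler_wpM2l (expR_ge0 _) (expr_1B_le (n - k) x1)) _.
rewrite -expRD ler_expR natrB // mulrBl.
have kx : k%:R * p ^+ k <= k%:R by rewrite ler_piMr.
by move: large; rewrite -natr1 mulrDl; lra.
Qed.

Lemma le_expR_half (R : realType) (t : R) : 0 <= t -> t <= expR (t / 2).
Proof.
move=> t0; have -> : t / 2 = 2%:R * (t / 4) by field.
rewrite expRM_natl.
apply: (@le_trans _ _ ((1 + t / 4) ^+ 2)).
  have := sqr_ge0 (1 - t / 4); rewrite !expr2; lra.
apply: lerXn2r; rewrite ?nnegrE ?expR_ge0 //; last exact: expR_ge1Dx.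
lra.
Qed.

Lemma expR_le_1B (R : realType) (y : R) : 0 <= y <= 1 / 2 -> expR (- (2 * y)) <= 1 - y.
Proof.
move=> /andP[y0 y2]; rewrite expRN.
apply: (@le_trans _ _ (1 + 2 * y)^-1).
  rewrite lef_pV2 ?posrE ?expR_gt0 ?expR_ge1Dx //; lra.
rewrite -[leLHS]mul1r ler_pdivrMr; last lra.
have : 0 <= y * (1 - 2 * y) by apply: mulr_ge0 => //; lra.
lra.
Qed.

(** The choice of s balances two requirements: e^(2s) blocks must be few enough
    to span no edge, and many enough that one of them succeeds when each does
    with probability e^(-s).  The bound on p gives p <= e^(-8s), so the expected
    number of edges inside U is O(e^(4s-8s)); and the probability that no block
    succeeds is at most exp(-(e^(2s) - 1) e^(-s)) <= e^(-s). *)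
Lemma bad_blocks_estimate (R : realType) (k n M : nat) (p : R) :
  let Y : R := (2 ^ M)%:R in
  let s : R := ln n%:R / (16 * k.+1%:R) in
  let m := Num.truncn (expR (2 * s)) in
  0 <= p <= 1 -> (0 < n)%N -> 2 * Y <= ln n%:R ->
  n%:R * p ^+ k.+1 < (32 * k.+1%:R * Y)^-1 * ln n%:R ->
  [/\ (m * M <= n)%N, Y * p ^+ k.+1 <= 1 &
    ((m * M) ^ 2)%:R * p + (1 - (1 - Y * p ^+ k.+1) ^+ n) ^+ m
      <= ((M ^ 2)%:R + 1) * expR (- s)].
Proof.
move=> Y s m /andP[p0 p1] n0 tY small.
have nE : n%:R = expR (ln n%:R) :> R by rewrite lnK // posrE ltr0n.
set t := ln n%:R in nE tY small s m *.
have Y1 : 1 <= Y by rewrite /Y ler1n expn_gt0.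
have K1 : 1 <= k.+1%:R :> R by rewrite ler1n.
set K : R := k.+1%:R in K1 small s m *.
have K0 : 0 < K by lra.
have t0 : 0 < t by lra.
have c1 : (32 * K * Y)^-1 <= 1.
  rewrite invf_le1; last by rewrite !mulr_gt0 //; lra.
  by have := ler_pM ler01 ler01 K1 Y1; rewrite mulr1; lra.
have sE : t = 16 * K * s by rewrite /s; field; rewrite gt_eqF.
have s0 : 0 < s by rewrite /s divr_gt0 // mulr_gt0.
have mle : m%:R <= expR (2 * s).
  by have /andP[] := truncn_itv (expR_ge0 (2 * s)).
have mgt : expR (2 * s) < m%:R + 1.
  by have /andP[_] := truncn_itv (expR_ge0 (2 * s)); rewrite natr1.
(* t <= e^(t/2) absorbs the logarithm in p^(k+1) < c t e^(-t). *)
have thalf := le_expR_half (ltW t0).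
have st : s <= t / 16.
  rewrite sE; have := ler_wpM2r (ltW s0) K1; lra.
have xle : p ^+ k.+1 <= expR (- (t / 2)).
  have : n%:R * p ^+ k.+1 <= n%:R * expR (- (t / 2)).
    rewrite [X in _ <= X * _]nE -expRD; have -> : t + - (t / 2) = t / 2 by field.
    apply: le_trans (ltW small) (le_trans _ thalf).
    by rewrite ler_piMl // ltW.
  by rewrite ler_pM2l // ltr0n.
have ple : p <= expR (- (8 * s)).
  rewrite -(@ler_pXn2r _ k.+1) ?nnegrE ?expR_ge0 // -expRM_natl -/K.
  by have -> : K * - (8 * s) = - (t / 2) by rewrite sE; field.
have x0 : 0 <= p ^+ k.+1 by apply: exprn_ge0.
have yle : Y * p ^+ k.+1 <= 1 / 2.
  have : p ^+ k.+1 <= (2 * Y)^-1.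
    apply: le_trans xle _; rewrite expRN lef_pV2 ?posrE ?expR_gt0 //; first lra.
    lra.
  move=> /(ler_wpM2l (le_trans ler01 Y1)) /le_trans; apply.
  by rewrite le_eqVlt; apply/orP; left; apply/eqP; field; rewrite gt_eqF //; lra.
have y0 : 0 <= Y * p ^+ k.+1 by rewrite mulr_ge0 //; lra.
set y := Y * p ^+ k.+1 in yle y0 *.
split; last 1 first.
- rewrite mulrDl mul1r; apply: lerD.
    rewrite expnMn mulnC natrM -mulrA ler_wpM2l //.
    apply: (@le_trans _ _ (expR (2 * s) ^+ 2 * expR (- (8 * s)))).
      rewrite natrX; apply: ler_pM => //.
      by apply: lerXn2r; rewrite ?nnegrE ?expR_ge0.
    by rewrite -expRM_natl -expRD ler_expR; lra.
  (* The constant c = 1 / (32 (k+1) Y) makes 2 n y at most s. *)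
  have ge : expR (- s) <= (1 - y) ^+ n.
    apply: (@le_trans _ _ (expR (- (2 * y)) ^+ n)); last first.
      by apply: lerXn2r; rewrite ?nnegrE ?expR_ge0 ?expR_le_1B ?y0 //; lra.
    rewrite -expRM_natl ler_expR.
    have : Y * (n%:R * p ^+ k.+1) <= Y * ((32 * K * Y)^-1 * t).
      by apply: ler_wpM2l (ltW small); lra.
    have -> : Y * ((32 * K * Y)^-1 * t) = s / 2.
      by rewrite /s; field; rewrite !gt_eqF //; lra.
    have -> : n%:R * - (2 * y) = - (2 * (Y * (n%:R * p ^+ k.+1))).
      by rewrite /y; ring.
    lra.
  have y1n : (1 - y) ^+ n <= 1 by apply: exprn_ile1; lra.
  apply: (@le_trans _ _ ((1 - expR (- s)) ^+ m)).
    by apply: lerXn2r; rewrite ?nnegrE ?subr_ge0 ?(le_trans ge) // lerB.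
  apply: le_trans (expr_1B_le _ (le_trans ge y1n)) _; rewrite ler_expR lerN2.
  have : (expR (2 * s) - 1) * expR (- s) <= m%:R * expR (- s).
    by apply: ler_wpM2r; rewrite ?expR_ge0 //; lra.
  apply: le_trans; rewrite mulrBl mul1r -expRD.
  have -> : 2 * s + - s = s by ring.
  have := expR_ge1Dx s; have : expR (- s) <= 1 by rewrite -expR0 ler_expR; lra.
  lra.
- rewrite -(ler_nat R) natrM nE.
  apply: (@le_trans _ _ (expR (2 * s) * expR (t / 2))).
    apply: ler_pM => //; apply: le_trans thalf; apply: le_trans tY.
    have : M%:R <= Y by rewrite /Y ler_nat ltnW // ltn_expl.
    lra.
  by rewrite -expRD ler_expR; lra.
- by lra.
Qed.

(** * The two thresholds *)

Lemma eq_whp (R : realType) (p : nat -> R) (A B : forall n, pred (sgraph 'I_n)) :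
  (forall n G, A n G = B n G) -> whp p B -> whp p A.
Proof.
move=> AB; suff E : (fun n => gnp_prob (p n) (A n)) = (fun n => gnp_prob (p n) (B n)).
  by rewrite /whp E.
by apply/funext => n; apply: eq_bigl => G; rewrite AB.
Qed.

Lemma whp_tc_le (R : realType) (r k h : nat) (p : nat -> R) :
  (0 < r)%N -> hp_max r k h -> (forall n, 0 <= p n <= 1) ->
  (\forall n \near \oo%classic, k.+1%:R * ln n%:R < n%:R * p n ^+ k) ->
  whp p (fun n (G : sgraph 'I_n) => (tc r G <= h)%N).
Proof.
move=> r0 hmax p01 large.
apply: (whp_of_bound (K := expR k%:R) (d := 1)) => //; near=> n.
have n0 : (0 < n)%N by near: n; exact: nbhs_infty_gt.
have kn : (k <= n)%N by near: n; exact: nbhs_infty_ge.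
have big : k.+1%:R * ln n%:R < n%:R * p n ^+ k by near: n; exact: large.
apply: le_trans (gnp_prob_ge (p01 n) (Bad := fun F =>
  [exists t : {ffun 'I_k -> 'I_n}, [forall w, [exists a, [set w; t a] \notin F]]]) _).
  rewrite lerB //; apply: le_trans (prob_some_tuple_without_neighbour (p01 n) kn) _.
  exact: common_neighbour_estimate.
move=> G /existsPn good.
apply: (tc_le_hp (Ordinal n0) r0 hmax) => t.
have /forallPn[w /existsPn wt] := good [ffun a => t a].
by exists w => a; have := wt a; rewrite negbK ffunE.
Unshelve. all: by end_near. Qed.

(** Vertices of other blocks see nothing of the block j, since the union of the
    blocks is independent. *)
Lemma tc_gt_of_good_block (V VH : finType) (G : sgraph V) (r k m : nat)
    (part : VH -> 'I_r) (H : {set {set VH}})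
    (g : 'I_m * option {set VH} -> V) (j : 'I_m) :
  (0 < r)%N -> uniform r H -> partite part H -> covering_property k part H ->
  injective g ->
  (forall x y, [set g x; g y] \notin edges G) ->
  (forall w, w \notin [set g x | x : 'I_m * option {set VH}] ->
     #|[set v in [set g (j, a) | a : option {set VH}] | [set v; w] \in edges G]| <= k)%N ->
  (cover_number H < tc r.+1 G)%N.
Proof.
move=> r0 uH pH cH g_inj indep deg.
pose f e := g (j, Some e).
have f_inj : injective f by move=> e e' /g_inj[].
apply: (tc_gt_cover_number (f := f) (w0 := g (j, None)) r0 uH pH cH).
- by move=> e e' _ _; apply: f_inj.
- by move=> e e' _ _; apply: indep.
- move=> w _; have [wU|wU] := boolP (w \in [set g x | x : 'I_m * option {set VH}]).
    have /imsetP[x _ ->] := wU.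
    rewrite (_ : [set e in H | _] = set0) ?cards0 //; apply/setP => e.
    by rewrite !inE (negbTE (indep _ _)) andbF.
  apply: leq_trans (deg w wU); rewrite -(card_imset _ f_inj).
  apply/subset_leq_card/fintype.subsetP => _ /imsetP[e + ->].
  by rewrite !inE => /andP[_ ->]; rewrite andbT; apply: imset_f.
- by apply/negP => /imsetP[e _ /g_inj].
- by move=> e _; apply: indep.
Qed.

Lemma whp_tc_gt (R : realType) (r k h : nat) : (0 < r)%N -> hp_value r k h ->
  exists2 c : R, 0 < c & forall p : nat -> R, (forall n, 0 <= p n <= 1) ->
  (\forall n \near \oo%classic, n%:R * p n ^+ k.+1 < c * ln n%:R) ->
  whp p (fun n (G : sgraph 'I_n) => (h < tc r.+1 G)%N).
Proof.
move=> r0 [VH [part [H [uH pH cH <-]]]].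
(* Some e indexes the vertex for the edge e, and None the spare vertex w0. *)
pose J : finType := option {set VH}.
exists (32 * k.+1%:R * (2 ^ #|J|)%:R)^-1.
  by rewrite invr_gt0 !mulr_gt0 // ltr0n expn_gt0.
move=> p p01 small.
apply: (whp_of_bound (K := (#|J| ^ 2)%:R + 1) (d := (16 * k.+1%:R)^-1)) => //; near=> n.
have n0 : (0 < n)%N by near: n; exact: nbhs_infty_gt.
have lnn : 2 * (2 ^ #|J|)%:R <= ln n%:R :> R by near: n; exact: near_ln_ge.
have smalln : n%:R * p n ^+ k.+1 < (32 * k.+1%:R * (2 ^ #|J|)%:R)^-1 * ln n%:R.
  by near: n; exact: small.
have [] := bad_blocks_estimate (p01 n) n0 lnn smalln.
set m := Num.truncn _ => mJn y1 est.
have mJ : (#|{: 'I_m * J}| <= n)%N by rewrite card_prod card_ord.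
pose g (x : 'I_m * J) := widen_ord mJ (enum_rank x).
have g_inj : injective g.
  by move=> x y /(congr1 val) /= xy; apply: enum_rank_inj; apply: val_inj.
apply: le_trans (gnp_prob_ge (p01 n) (Bad := fun F =>
   [exists x : ('I_m * J) * ('I_m * J), [set g x.1; g x.2] \in F]
   || [forall j, ~~ good_block k g F j]) _).
  rewrite lerB //; apply: le_trans (prob_bad_blocks (p01 n) g_inj y1) _.
  by rewrite [_^-1 * _]mulrC.
move=> G; rewrite negb_or => /andP[/existsPn indep /forallPn[j]].
rewrite negbK => /forall_inP good.
apply: (tc_gt_of_good_block (j := j) r0 uH pH cH g_inj) => // x y.
exact: indep (x, y).
Unshelve. all: by end_near. Qed.

Local Open Scope classical_set_scope.
Local Open Scope ring_scope.

Theorem theorem1p5 (R : realType) (k r : nat) (hr : (2 <= r)%N) (hk : (r < k)%N) :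
  exists C c : R, [/\ 0 < C, 0 < c &
    forall p : nat -> R, (forall n, 0 <= p n <= 1) ->
      ((\forall n \near \oo, C * ln n%:R < n%:R * p n ^+ k) ->
        whp p (fun n (G : sgraph 'I_n) => ((tc r G)%:R%:E <= hp R r k)%E))
      /\
      ((\forall n \near \oo, n%:R * p n ^+ k.+1 < c * ln n%:R) ->
        whp p (fun n (G : sgraph 'I_n) => (hp R r k + 1 <= (tc r.+1 G)%:R%:E)%E))].
Proof.
have r0 : (0 < r)%N by apply: leq_trans hr.
have [h hmax] := hp_max_exists r0 hk.
have [c c0 lower] := whp_tc_gt R r0 (proj1 hmax).
exists k.+1%:R, c; split=> // p p01; rewrite (hpE R hmax); split=> [large|small].
- apply: eq_whp (whp_tc_le r0 hmax p01 large) => n G.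
  by rewrite lee_fin ler_nat.
- apply: eq_whp (lower p p01 small) => n G.
  by rewrite -EFinD lee_fin natr1 ler_nat.
Qed.
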